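(* Let $\lambda$ be a strict partition with inner corner contents $x_0,\dots,x_m$ and outer corner contents $y_1,\dots,y_m$, let $0\le i\le m$, and let $\lambda^+=\lambda\cup\{\square\}$ be a strict partition obtained from $\lambda$ by adding one box $\square$ with $c_\square=x_i$. If $i=0$, then $$\frac{H_\lambda}{H_{\lambda^+}}=\frac{\prod_{1\le j\le m}\bigl(\binom{x_0}{2}-\binom{y_j}{2}\bigr)}{\prod_{1\le j\le m}\bigl(\binom{x_0}{2}-\binom{x_j}{2}\bigr)}.$$ If $1\le i\le m$, then $$\frac{H_\lambda}{H_{\lambda^+}}=\frac12\cdot\frac{\prod_{1\le j\le m}\bigl(\binom{x_i}{2}-\binom{y_j}{2}\bigr)}{\prod_{0\le j\le m,\ j\ne i}\bigl(\binom{x_i}{2}-\binom{x_j}{2}\bigr)}.$$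
   Context: A strict partition is a finite strictly decreasing sequence of positive integers $\lambda=(\lambda_1>\cdots>\lambda_\ell)$ (the empty sequence is allowed); $|\lambda|=\sum_i\lambda_i$, $\ell(\lambda)=\ell$, and $\lambda_i=0$ for $i>\ell(\lambda)$. The (shifted Young) diagram of $\lambda$ is the set of boxes $(i,j)$ with $1\le i\le\ell(\lambda)$, $i+1\le j\le i+\lambda_i$ (row $i$, column $j$); $\lambda$ is identified with its diagram. The content of $\square=(i,j)$ is $c_\square=j-i$. The hook length $h_\square$ of $\square=(i,j)\in\lambda$ is the number of boxes of $\lambda$ in row $i$ strictly to the right of $\square$, plus the number of boxes $(i',j)\in\lambda$ with $i'>i$, plus $1$, plus $\lambda_j$; $H_\lambda=\prod_{\square\in\lambda}h_\square$. Corners: an outer corner of $\lambda$ is a box of $\lambda$ whose removal leaves the diagram of a strict partition. Let $(\alpha_1,\beta_1),\dots,(\alpha_m,\beta_m)$ be the outer corners with $\alpha_1>\cdots>\alpha_m$, and $y_j=\beta_j-\alpha_j$ ($1\le j\le m$) their contents. Set $\alpha_{m+1}=0$, $\beta_0=\ell(\lambda)+1$, and $x_i=\beta_i-\alpha_{i+1}$ for $0\le i\le m$ (contents of the inner corners). One has $x_0=1\le y_1<x_1<y_2<\cdots<y_m<x_m$. *)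

(* Defs.v *)
From mathcomp Require Import all_boot all_order all_algebra.
Set Implicit Arguments. Unset Strict Implicit. Unset Printing Implicit Defensive.
Import Order.TTheory GRing.Theory Num.Theory.

Definition strict (lam : seq nat) : bool :=
  sorted (fun a b => b < a) lam && all (fun a => 0 < a) lam.

(* lambda_i, 1-indexed; 0 for i > length *)
Definition part (lam : seq nat) (i : nat) : nat := nth 0 lam i.-1.

Definition in_diag (lam : seq nat) (b : nat * nat) : bool :=
  let: (i, j) := b in (1 <= i <= size lam) && (i.+1 <= j <= i + part lam i).

Definition boxes (lam : seq nat) : seq (nat * nat) :=
  flatten [seq [seq (i, j) | j <- iota i.+1 (part lam i)] | i <- iota 1 (size lam)].

Definition content (b : nat * nat) : nat := b.2 - b.1.

Definition hook (lam : seq nat) (b : nat * nat) : nat :=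
  let: (i, j) := b in
  (i + part lam i - j)
  + count (fun i' => in_diag lam (i', j)) (iota i.+1 (size lam - i))
  + 1 + part lam j.

Definition Hprod (lam : seq nat) : nat := \prod_(b <- boxes lam) hook lam b.

Definition outer_corner (lam : seq nat) (b : nat * nat) : Prop :=
  in_diag lam b /\
  exists mu : seq nat, strict mu /\
    forall c, in_diag mu c = in_diag lam c && (c != b).

(* inner corner contents x_i = beta_i - alpha_{i+1}, alpha_{m+1} = 0,
   beta_0 = l(lam) + 1 *)
Definition xc (lam : seq nat) (m : nat) (alpha beta : nat -> nat) (i : nat) : nat :=
  (if i == 0 then (size lam).+1 else beta i) - (if i == m then 0 else alpha i.+1).

Definition yc (alpha beta : nat -> nat) (j : nat) : nat := beta j - alpha j.

Definition binom2 (x : nat) : rat := ('C(x, 2))%:R.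

(* Main.v *)
Require Import Defs.
From mathcomp Require Import all_boot all_order all_algebra.
From mathcomp Require Import zify ring lra.
Import Order.TTheory GRing.Theory Num.Theory.
Local Open Scope ring_scope.

(* The hooks of row i of a shifted diagram give
   H_lam = prod_i lam_i! * prod_{i<j} (lam_i + lam_j) / (lam_i - lam_j).
   Adding a box of content x = lam_k + 1 to row k therefore yields
   H_lam / H_lam+ = 1/x * prod_{j <> k} (B(x) - B(lam_j)) / (B(x) - B(lam_j + 1)), B(v) = binom(v, 2).
   Along a run of consecutive parts this product telescopes: only the smallest part of the run (an
   outer corner content) survives upstairs, and one plus the largest part (an inner corner content)
   downstairs. *)

(** * Inequalities between the parts of a strict partition *)

Lemma strict_nth_gt0 {lam : seq nat} {i : nat} :
  strict lam -> (i < size lam)%N -> (0 < nth 0%N lam i)%N.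
Proof. by case/andP=> _ /(all_nthP 0%N) H /H. Qed.

Lemma strict_ltn_nth {lam : seq nat} {i j : nat} :
  strict lam -> (i < j)%N -> (i < size lam)%N -> (nth 0%N lam j < nth 0%N lam i)%N.
Proof.
move=> sl ltij lti; case: (ltnP j (size lam)) => ltj; last first.
  by rewrite [nth _ _ j]nth_default // strict_nth_gt0.
case/andP: sl => sl _.
apply: (@sorted_ltn_nth _ (fun a b => b < a)%N _ 0%N _ sl) => //.
by move=> y x z /= h1 h2; apply: ltn_trans h2 h1.
Qed.

Lemma strict_nth_inj {lam : seq nat} {i j : nat} :
    strict lam -> (i < size lam)%N -> nth 0%N lam i = nth 0%N lam j -> i = j.
Proof.
move=> sl lti e; case: (ltngtP i j) => // h; first by have := strict_ltn_nth sl h lti; lia.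
by have := strict_ltn_nth sl h (ltn_trans h lti); lia.
Qed.

Lemma strictP (lam : seq nat) :
  (forall i, (i < size lam)%N -> (nth 0%N lam i.+1 < nth 0%N lam i)%N) -> strict lam.
Proof.
move=> H; apply/andP; split; last by apply/(all_nthP 0%N) => i /H; apply: leq_ltn_trans.
by apply/(sortedP 0%N) => i /ltnW /H.
Qed.

(** Up to a constant shift, [j + nth 0 lam j] is the last column of a row. Going down one row costs
    the part at least 1, so row ends move weakly to the left. *)
Lemma strict_nth_addn {lam : seq nat} {i j : nat} :
  strict lam -> (i <= j < size lam)%N -> (j + nth 0%N lam j <= i + nth 0%N lam i)%N.
Proof.
move=> sl /andP[]; elim: j => [|j IH]; first by rewrite leqn0 => /eqP->.
rewrite leq_eqVlt => /orP[/eqP-> //|ltij] ltj.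
have := IH ltij (ltnW ltj); have := strict_ltn_nth sl (ltnSn j) (ltnW ltj); lia.
Qed.

Lemma strict_size_leq {lam : seq nat} {i : nat} :
  strict lam -> (i < size lam)%N -> (size lam <= i + nth 0%N lam i)%N.
Proof.
move=> sl lti; have lt1 : ((size lam).-1 < size lam)%N by lia.
have := @strict_nth_addn lam i (size lam).-1 sl; have := strict_nth_gt0 sl lt1.
move=> h1 h2; have {h2} : ((size lam).-1 + nth 0%N lam (size lam).-1 <= i + nth 0%N lam i)%N.
  by apply: h2; lia.
lia.
Qed.

(** * Hook lengths along one row *)

Lemma in_diagE (lam : seq nat) (i j : nat) :
  in_diag lam (i, j) = (0 < i)%N && (i < j <= i + part lam i)%N.
Proof.
rewrite /in_diag /part; case: i => //= i.
case: (ltnP i (size lam)) => //= h; rewrite nth_default //; lia.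
Qed.

(** A downward closed predicate holds on an initial segment of the interval, so its count locates
    the point where it stops holding. *)
Lemma count_iota_downclosed (P : pred nat) (a n t : nat) :
  (forall u v, (u <= v)%N -> P v -> P u) ->
  (a <= t < a + n)%N -> P t = (t < a + count P (iota a n))%N.
Proof.
move=> dP /andP[leat ltt].
have -> : n = ((t - a).+1 + (n - (t - a).+1))%N by lia.
rewrite iotaD count_cat.
case Pt: (P t).
  have -> : count P (iota a (t - a).+1) = (t - a).+1.
    rewrite -[RHS](size_iota a); apply/eqP; rewrite -all_count.
    apply/allP => u; rewrite mem_iota => hu; apply: dP Pt; lia.
  by apply/esym; lia.
have -> : (count P (iota (a + (t - a).+1) (n - (t - a).+1)) = 0)%N.
  apply/eqP; rewrite eqn0Ngt -has_count; apply/hasPn => u; rewrite mem_iota => hu.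
  by apply/negP => Pu; move/negP: Pt; apply; apply: dP Pu; lia.
rewrite -[(t - a).+1]addn1 iotaD count_cat /= subnKC // Pt !addn0.
have := count_size P (iota a (t - a)); rewrite size_iota; lia.
Qed.

(** Every row reaches column [size lam + 1], while a row starts just right of the diagonal. Hence
    below row [i.+1], column [j.+1] meets exactly the rows up to [j]; the arm and leg lengths then
    cancel [i] and [j]. *)
Lemma hook_left (lam : seq nat) (i j : nat) :
  strict lam -> (i < j < size lam)%N ->
  hook lam (i.+1, j.+1) = (nth 0%N lam i + nth 0%N lam j)%N.
Proof.
move=> sl /andP[ltij ltj]; rewrite /hook /part /=.
have -> : count (fun i' => in_diag lam (i', j.+1)) (iota i.+2 (size lam - i.+1)) = (j - i.+1)%N.
  have -> : (size lam - i.+1 = (j - i.+1) + (size lam - j))%N by lia.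
  rewrite iotaD count_cat.
  have -> : count (fun i' => in_diag lam (i', j.+1)) (iota i.+2 (j - i.+1)) = (j - i.+1)%N.
    rewrite -[RHS](size_iota i.+2); apply/eqP; rewrite -all_count.
    apply/allP => -[|u]; rewrite mem_iota => hu; first lia.
    rewrite in_diagE /part /=; have := @strict_size_leq lam u sl; lia.
  rewrite (_ : count _ _ = 0)%N ?addn0 //; apply/eqP; rewrite eqn0Ngt -has_count.
  apply/hasPn => u; rewrite mem_iota in_diagE; lia.
have := @strict_size_leq lam i sl; lia.
Qed.

Section HooksBeyondLength.

Variables (lam : seq nat) (i : nat).
Hypotheses (sl : strict lam) (lti : (i < size lam)%N).

Let leg j := count (fun i' => in_diag lam (i', j)) (iota i.+2 (size lam - i.+1)).

Lemma hook_right j : (size lam < j)%N ->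
  hook lam (i.+1, j) = (i.+1 + nth 0%N lam i - j + leg j + 1)%N.
Proof. move=> h; rewrite /hook [X in (_ + X)%N](_ : part lam j = 0%N) ?addn0 //.
by rewrite /part nth_default //; lia. Qed.

Lemma leq_leg j t : (size lam < j)%N -> (i < t < size lam)%N ->
  (j <= t.+1 + nth 0%N lam t)%N = (t < i.+1 + leg j)%N.
Proof.
move=> ltj ht.
(* [P] agrees with membership of column [j] on the counted rows. The value at 0, outside that range,
   is set to true to make [P] downward closed on all of [nat]. *)
pose P u := [|| u == 0%N | (u <= size lam) && (j <= u + part lam u)]%N.
have -> : leg j = count P (iota i.+2 (size lam - i.+1)).
  apply: eq_in_count => u; rewrite mem_iota in_diagE /P => hu.
  by apply/idP/idP; lia.
have -> : (j <= t.+1 + nth 0%N lam t)%N = P t.+1 by rewrite /P /part /=; lia.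
rewrite (@count_iota_downclosed P i.+2 (size lam - i.+1) t.+1) ?addSn ?ltnS //; last lia.
move=> [|u] [|v] //=; rewrite /P /part //=; try lia.
move=> leuv /andP[h1 h2]; apply/andP; split; first lia.
by have := @strict_nth_addn lam u v sl; lia.
Qed.

Lemma leg_leq j : (leg j <= size lam - i.+1)%N.
Proof. by rewrite -[X in (_ <= X)%N](size_iota i.+2) count_size. Qed.

Lemma leg_mono j j' : (j <= j')%N -> (size lam < j)%N -> (leg j' <= leg j)%N.
Proof.
move=> le lt; rewrite /leg -!size_filter; apply: uniq_leq_size; first by rewrite filter_uniq ?iota_uniq.
by move=> u; rewrite !mem_filter !mem_iota !in_diagE; lia.
Qed.

(** All listed values lie between 1 and the part of row [i], they are pairwise distinct, and there
    are as many of them as the part, so they exhaust the interval. *)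
Lemma perm_hooks_right :
  perm_eq ([seq hook lam (i.+1, j) | j <- iota (size lam).+1 (i.+1 + nth 0%N lam i - size lam)]
           ++ [seq (nth 0%N lam i - nth 0%N lam t)%N | t <- iota i.+1 (size lam - i.+1)])
          (iota 1 (nth 0%N lam i)).
Proof.
have szi := strict_size_leq sl lti.
set s := _ ++ _.
have us : uniq s.
  rewrite cat_uniq; apply/and3P; split.
  - rewrite map_inj_in_uniq ?iota_uniq // => u v; rewrite !mem_iota => hu hv.
    rewrite !hook_right; try lia.
    case: (leqP u v) => h; first by have := @leg_mono u v h; lia.
    by have := @leg_mono v u (ltnW h); lia.
  - apply/hasPn => v /mapP[t]; rewrite mem_iota => ht ->.
    (* Equality would give [j = i + leg j + 2 + nth 0 lam t]. Then row [t] would reach column [j]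
       exactly when it is not counted in the leg, against [leq_leg]. *)
    apply/negP => /mapP[j]; rewrite mem_iota => hj; rewrite hook_right; last lia.
    have := @leq_leg j t; have := leg_leq j.
    have := @strict_ltn_nth lam i t sl; have := @strict_nth_gt0 lam t sl.
    lia.
  - rewrite map_inj_in_uniq ?iota_uniq // => u v; rewrite !mem_iota => hu hv e.
    apply: (strict_nth_inj sl); first lia.
    have := @strict_ltn_nth lam i u sl; have := @strict_ltn_nth lam i v sl; lia.
have ss : {subset s <= iota 1 (nth 0%N lam i)}.
  move=> v; rewrite mem_cat => /orP[]/mapP[j]; rewrite !mem_iota => hj ->.
    rewrite hook_right; last lia.
    have := leg_leq j; lia.
  have := @strict_ltn_nth lam i j sl; have := @strict_nth_gt0 lam j sl; lia.
apply: uniq_perm => //; first exact: iota_uniq.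
have [] // := uniq_min_size us ss.
by rewrite size_cat !size_map !size_iota; lia.
Qed.

(** The row is cut after column [size lam]: the left piece consists of the sums by [hook_left], and
    the right piece together with the differences forms the factorial. *)
Lemma row_hooks :
  (\prod_(j <- iota i.+2 (nth 0%N lam i)) hook lam (i.+1, j)
     * \prod_(i.+1 <= t < size lam) (nth 0%N lam i - nth 0%N lam t)
   = (nth 0%N lam i)`! * \prod_(i.+1 <= t < size lam) (nth 0%N lam i + nth 0%N lam t))%N.
Proof.
have szi := strict_size_leq sl lti.
have -> : iota i.+2 (nth 0%N lam i)
  = iota i.+2 (size lam - i.+1) ++ iota (size lam).+1 (i.+1 + nth 0%N lam i - size lam).
  rewrite -[(size lam).+1 in RHS](_ : (i.+2 + (size lam - i.+1))%N = _); last lia.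
  by rewrite -iotaD; congr iota; lia.
rewrite big_cat -mulnA mulnC; congr (_ * _)%N.
  rewrite -(big_map (fun t => nth 0%N lam i - nth 0%N lam t)%N xpredT id).
  rewrite -(big_map (fun j => hook lam (i.+1, j)) xpredT id) -big_cat.
  by rewrite (perm_big _ perm_hooks_right) fact_prod /index_iota subn1.
rewrite -[i.+2]add1n iotaDl big_map /index_iota big_seq [RHS]big_seq.
apply: eq_bigr => j; rewrite mem_iota add1n => hj; apply: hook_left => //; lia.
Qed.

End HooksBeyondLength.

(** * Product formula for the hook product *)

Lemma Hprod_nat (lam : seq nat) : strict lam ->
  (Hprod lam * \prod_(0 <= i < size lam) \prod_(i.+1 <= j < size lam) (nth 0%N lam i - nth 0%N lam j)
   = (\prod_(0 <= i < size lam) (nth 0%N lam i)`!)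
     * \prod_(0 <= i < size lam) \prod_(i.+1 <= j < size lam) (nth 0%N lam i + nth 0%N lam j))%N.
Proof.
move=> sl; rewrite /Hprod /boxes big_flatten big_map /=.
rewrite -[X in iota X _]addn0 iotaDl big_map -[X in iota _ X]subn0 -/(index_iota 0 (size lam)).
rewrite -!big_split /=.
rewrite big_nat [RHS]big_nat; apply: eq_bigr => i /= hi.
by rewrite add1n big_map row_hooks.
Qed.

Lemma prod_triangle_recr (R : comPzRingType) (w : nat -> nat -> R) (n : nat) :
  \prod_(0 <= i < n.+1) \prod_(i.+1 <= j < n.+1) w i j
  = \prod_(0 <= i < n) \prod_(i.+1 <= j < n) w i j * \prod_(0 <= i < n) w i n.
Proof.
rewrite big_nat_recr //= [X in _ * X = _]big_geq // mulr1 -big_split /=.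
by rewrite big_nat [RHS]big_nat; apply: eq_bigr => i /= hi; rewrite big_nat_recr.
Qed.

Lemma prod_triangle_cross (R : comPzRingType) (w : nat -> nat -> R) (n k : nat) :
    (forall i j, w i j = w j i) ->
    (forall i j, (i < j < n)%N -> i != k -> j != k -> w i j = 1) ->
  (k < n)%N ->
  \prod_(0 <= i < n) \prod_(i.+1 <= j < n) w i j = \prod_(0 <= j < n | j != k) w k j.
Proof.
move=> wC w1 ltk.
(* The induction is on a truncation [N] of the triangle: the product stays 1 until row [k] enters,
   and afterwards each new index contributes only its pair with [k]. *)
have H N : (N <= n)%N -> \prod_(0 <= i < N) \prod_(i.+1 <= j < N) w i j
    = if (k < N)%N then \prod_(0 <= j < N | j != k) w k j else 1.
  elim: N => [|N IH] leN; first by rewrite big_geq.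
  rewrite prod_triangle_recr {}IH ?(ltnW leN) // ltnS; case: (ltngtP k N) => [ltkN|ltNk|e] /=.
  - have -> : \prod_(0 <= i < N) w i N = w k N.
      rewrite (bigD1_seq k) ?iota_uniq ?mem_index_iota //= big1_seq ?mulr1 // => j.
      by rewrite mem_index_iota => hj; apply: w1; lia.
    by rewrite [RHS]big_mkcond big_nat_recr //= -big_mkcond (gtn_eqF ltkN).
  - by rewrite mul1r big_nat big1 // => j hj; apply: w1; lia.
  rewrite mul1r e [RHS]big_mkcond big_nat_recr //= eqxx mulr1.
  rewrite big_nat [RHS]big_nat; apply: eq_bigr => j /= hj.
  by rewrite wC ifT //; lia.
by rewrite H // ltk.
Qed.

(** A padding part 0 is harmless, as [0! = 1] and its pair factors are [lam_i / lam_i]. This lets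
    [lam] and [lamp] share one index range when the new box opens a row; a second zero would bring
    in 0/0. *)
Lemma Hprod_rat (lam : seq nat) (n : nat) :
    strict lam -> (size lam <= n <= (size lam).+1)%N ->
  (Hprod lam)%:R = \prod_(0 <= i < n) ((nth 0%N lam i)`!)%:R
    * \prod_(0 <= i < n) \prod_(i.+1 <= j < n)
        (((nth 0%N lam i)%:R + (nth 0%N lam j)%:R) / ((nth 0%N lam i)%:R - (nth 0%N lam j)%:R)) :> rat.
Proof.
move=> sl hn.
have E : (Hprod lam)%:R = \prod_(0 <= i < size lam) ((nth 0%N lam i)`!)%:R
    * \prod_(0 <= i < size lam) \prod_(i.+1 <= j < size lam)
        (((nth 0%N lam i)%:R + (nth 0%N lam j)%:R) / ((nth 0%N lam i)%:R - (nth 0%N lam j)%:R)) :> rat.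
  under [X in _ * X]eq_bigr => i _ do rewrite big_split prodfV.
  rewrite big_split prodfV /= mulrA; apply: canRL (mulfK _) _.
    rewrite prodf_seq_neq0; apply/allP => i; rewrite mem_index_iota => hi /=.
    rewrite prodf_seq_neq0; apply/allP => j; rewrite mem_index_iota => hj /=.
    rewrite subr_eq0 eqr_nat; have := @strict_ltn_nth lam i j sl; lia.
  have -> : \prod_(0 <= i < size lam) \prod_(i.+1 <= j < size lam)
      ((nth 0%N lam i)%:R - (nth 0%N lam j)%:R) =
      (\prod_(0 <= i < size lam) \prod_(i.+1 <= j < size lam) (nth 0 lam i - nth 0 lam j))%N%:R :> rat.
    rewrite natr_prod big_nat [RHS]big_nat; apply: eq_bigr => i hi.
    rewrite natr_prod big_nat [RHS]big_nat; apply: eq_bigr => j hj.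
    by rewrite natrB //; have := @strict_ltn_nth lam i j sl; lia.
  rewrite -natrM Hprod_nat // natrM !natr_prod; congr (_ * _); apply: eq_bigr => i _.
  by rewrite natr_prod; apply: eq_bigr => j _; rewrite natrD.
have [->//|->] : n = size lam \/ n = (size lam).+1 by lia.
rewrite E big_nat_recr //= nth_default // fact0 mulr1; congr (_ * _).
rewrite prod_triangle_recr nth_default // [X in _ * X]big_nat [X in _ * X]big1 ?mulr1 // => i hi.
by rewrite subr0 divff // pnatr_eq0 -lt0n strict_nth_gt0.
Qed.

(** * Effect of one added box on the hook product *)

Lemma binom2E (v : nat) : binom2 v = v%:R * (v%:R - 1) / 2.
Proof.
rewrite /binom2; elim: v => [|v IH]; first by rewrite !mul0r.
by rewrite binS bin1 natrD IH -[v.+1]addn1 natrD; field.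
Qed.

(** The difference is [(u - v)(u + v - 1) / 2], and its second factor is nonzero for positive [u],
    [v]. Positivity matters since [binom2] vanishes at both 0 and 1. *)
Lemma binom2_inj_gt0 (u v : nat) :
  (0 < u)%N -> (0 < v)%N -> binom2 u = binom2 v -> u = v.
Proof.
move=> u0 v0; rewrite !binom2E => H.
have {H} H : (u%:R - v%:R) * (u%:R + v%:R - 1) = 0 :> rat by lra.
move/eqP: H; rewrite mulf_eq0 subr_eq0 eqr_nat => /orP[/eqP//|].
by rewrite subr_eq0 -natrD pnatr_eq1; lia.
Qed.

(** The binomial differences on the right factor as [(a + 1 - c)(a + c) / 2] and
    [(a - c)(a + 1 + c) / 2]. *)
Lemma hook_factor_ratio (a c : nat) : c != a -> c != a.+1 ->
  ((a%:R + c%:R) / (a%:R - c%:R)) / ((a.+1%:R + c%:R) / (a.+1%:R - c%:R))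
  = (binom2 a.+1 - binom2 c) / (binom2 a.+1 - binom2 c.+1) :> rat.
Proof.
move=> h1 h2; rewrite !binom2E -[a.+1]addn1 -[c.+1]addn1 !natrD.
have : a%:R - c%:R != 0 :> rat by rewrite subr_eq0 eqr_nat eq_sym.
have : a%:R + 1 - c%:R != 0 :> rat by rewrite natr1 subr_eq0 eqr_nat eq_sym.
have : a%:R + 1 + c%:R != 0 :> rat by rewrite natr1 -natrD pnatr_eq0.
move: (a%:R : rat) (c%:R : rat) => A C n1 n2 n3.
have -> : (A + 1) * (A + 1 - 1) / 2 - (C + 1) * (C + 1 - 1) / 2 = (A - C) * (A + 1 + C) / 2.
  by field.
by field; rewrite n1 n2 n3.
Qed.

Lemma add_box_nth (lam lamp : seq nat) (b : nat * nat) :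
    ~~ in_diag lam b -> (forall c, in_diag lamp c = in_diag lam c || (c == b)) ->
  exists k, content b = (nth 0%N lam k).+1
    /\ forall j, nth 0%N lamp j = (nth 0 lam j + (j == k))%N.
Proof.
case: b => -[|k] l nb E.
  by have := E (0%N, l); rewrite !in_diagE eqxx.
exists k; have Er j c : (j < c <= j + nth 0 lamp j.-1)%N && (0 < j)%N
    = ((j < c <= j + nth 0 lam j.-1)%N && (0 < j)%N) || ((j, c) == (k.+1, l)).
  by have := E (j, c); rewrite !in_diagE /part ![(0 < j)%N && _]andbC.
have H j : nth 0%N lamp j = (nth 0 lam j + (j == k))%N /\ (j = k -> l = (k + (nth 0 lam k).+2)%N).
  (* Membership is tested at both row ends, at the two columns past the end in [lam], and at [l].
     This fixes the new part and forces the box to follow the row end directly. *)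
  have /= := Er j.+1 (j.+1 + nth 0 lamp j)%N.
  have /= := Er j.+1 (j.+1 + nth 0 lam j)%N.
  have /= := Er j.+1 (j.+1 + (nth 0 lam j).+1)%N.
  have /= := Er j.+1 (j.+1 + (nth 0 lam j).+2)%N.
  have /= := Er j.+1 l.
  move: nb; rewrite in_diagE /part /= !xpair_eqE !eqSS eqxx !andbT.
  case: (eqVneq j k) => [->|ne] /=; first by rewrite ?orbT /=; lia.
  by rewrite ?orbF; lia.
split; first by have [_ /(_ erefl) ->] := H k; rewrite /content /=; lia.
by move=> j; have [] := H j.
Qed.

Lemma Hprod_add_box (lam lamp : seq nat) (k : nat) (x := (nth 0%N lam k).+1) :
    strict lam -> strict lamp ->
    (forall j, nth 0%N lamp j = (nth 0 lam j + (j == k))%N) ->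
  [/\ (k < size lamp)%N, (size lam <= size lamp <= (size lam).+1)%N &
  (Hprod lam)%:R / (Hprod lamp)%:R = x%:R^-1 * \prod_(0 <= j < size lamp | j != k)
    ((binom2 x - binom2 (nth 0%N lam j)) / (binom2 x - binom2 (nth 0%N lam j).+1)) :> rat].
Proof.
move=> sl slp E.
have ltk : (k < size lamp)%N.
  by rewrite ltnNge; apply/negP => h; have := E k; rewrite eqxx nth_default //; lia.
(* Only row [k] can be new, since all other parts are unchanged. *)
have pos j : (j < size lamp)%N -> j != k -> (j < size lam)%N.
  move=> lt ne; have := strict_nth_gt0 slp lt; rewrite E (negPf ne) addn0 ltnNge => h.
  by rewrite ltnNge; apply: contra h => h; rewrite nth_default.
have hs : (size lam <= size lamp <= (size lam).+1)%N.
  apply/andP; split.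
    rewrite leqNgt; apply/negP => h; have := E (size lamp); have := strict_nth_gt0 sl h.
    by rewrite [nth _ lamp _]nth_default //; lia.
  by have := pos (size lam); have := pos (size lam).+1; lia.
split => //; rewrite (Hprod_rat _ _ sl hs) (Hprod_rat lamp (size lamp) slp); last by lia.
rewrite invfM mulrACA -!prodf_div /=; congr (_ * _).
  rewrite (bigD1_seq k) ?iota_uniq ?mem_index_iota //= big1 ?mulr1 => [|j ne].
    rewrite E eqxx addn1 factS natrM invfM mulrCA divff ?mulr1 //.
    by rewrite pnatr_eq0 -lt0n fact_gt0.
  by rewrite E (negPf ne) addn0 divff // pnatr_eq0 -lt0n fact_gt0.
under eq_bigr => i _ do rewrite -prodf_div.
pose g (p : seq nat) i j : rat := ((nth 0%N p i)%:R + (nth 0%N p j)%:R) / ((nth 0%N p i)%:R - (nth 0%N p j)%:R).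
(* [g] is antisymmetric in its two indices, so the quotient is symmetric; it is 1 on every pair
   avoiding [k]. *)
rewrite (prod_triangle_cross _ (fun i j => g lam i j / g lamp i j) _ k) //.
- rewrite big_seq_cond [RHS]big_seq_cond; apply: eq_bigr => j; rewrite mem_index_iota /g => /andP[hj ne].
  rewrite !E eqxx (negPf ne) addn1 addn0 hook_factor_ratio //.
    apply/eqP => e; have := strict_nth_inj sl _ e; have := pos j; lia.
  apply/eqP => e; have := @strict_nth_inj lamp j k slp; rewrite !E eqxx (negPf ne); lia.
- have gN p i j : g p i j = - g p j i by rewrite /g addrC -opprB invrN mulrN.
  by move=> i j; rewrite gN (gN lamp) invrN mulrNN.
move=> i j hij nik njk; rewrite /g !E (negPf nik) (negPf njk) !addn0 divff //.
have := @strict_ltn_nth lam i j sl; have := pos i; have := @strict_nth_gt0 lam i sl => h1 h2 h3.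
rewrite mulf_neq0 ?invr_eq0 //; first by rewrite -natrD pnatr_eq0; lia.
by rewrite subr_eq0 eqr_nat; lia.
Qed.

(** * Outer corners and the runs of consecutive parts between them *)

Lemma outer_corner_col (lam : seq nat) (c : nat * nat) : outer_corner lam c ->
  (0 < c.1 <= size lam)%N /\ c.2 = (c.1 + nth 0 lam c.1.-1)%N.
Proof.
case: c => a l [cl [mu [smu E]]]; have := cl; rewrite /in_diag /part => /andP[ha hl] /=.
split => //; apply/eqP; rewrite eqn_leq; apply/andP; split; first by lia.
rewrite leqNgt; apply/negP => lt.
(* Otherwise [mu] would lack column [l] but contain column [l.+1] of the same row. *)
have := E (a, l.+1); have := E (a, l); rewrite !in_diagE /part !xpair_eqE; lia.
Qed.

Lemma outer_corner_row (lam : seq nat) (a : nat) :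
    strict lam -> (a < size lam)%N ->
    (a.+1 == size lam) || ((nth 0 lam a.+1).+1 < nth 0 lam a)%N ->
  outer_corner lam (a.+1, a.+1 + nth 0 lam a)%N.
Proof.
move=> sl lta ha; have pa := strict_nth_gt0 sl lta.
split; first by rewrite in_diagE /part /=; lia.
(* A part equal to 1 can occur here only in the last row, which then disappears with its box. *)
pose n := (size lam - (nth 0%N lam a == 1%N))%N.
pose mu := mkseq (fun i => nth 0 lam i - (i == a))%N n.
have E1 : nth 0%N lam a = 1%N -> a.+1 = size lam by lia.
have Emu j : nth 0%N mu j = (nth 0 lam j - (j == a))%N.
  rewrite /mu; case: (ltnP j n) => hj; first by rewrite nth_mkseq.
  rewrite nth_default ?size_mkseq //; case: (ltnP j (size lam)) => hj'.
    have -> : j = a by move: hj; rewrite /n; case: eqP => //; lia.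
    by move: hj; rewrite /n eqxx; case: eqP; lia.
  by rewrite nth_default.
exists mu; split.
  apply: strictP => j; rewrite size_mkseq => hj; rewrite !Emu.
  have hj' : (j < size lam)%N by move: hj; rewrite /n; lia.
  have := @strict_ltn_nth lam j j.+1 sl (ltnSn j) hj'.
  case: (eqVneq j a) => [e|_]; last lia.
  rewrite e in hj hj' *; case/orP: ha => [/eqP e'|]; last lia.
  rewrite [nth _ _ a.+1]nth_default ?e' //; move: hj; rewrite /n; lia.
move=> [[|r] c]; rewrite !in_diagE // /part /= Emu xpair_eqE eqSS.
by case: (eqVneq r a) => [->|_] /=; lia.
Qed.

(** Inside the run [(p j.+1).+1] is [p j], so the two products differ only at their ends. The
    cross-multiplied form needs no nonvanishing assumption. *)
Lemma run_telescope (R : comPzRingType) (f : nat -> R) (p : nat -> nat) (a b : nat) :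
    (a < b)%N -> (forall j, (a <= j)%N -> (j.+1 < b)%N -> p j = (p j.+1).+1) ->
  \prod_(a <= j < b) f (p j) * f (p a).+1 = \prod_(a <= j < b) f (p j).+1 * f (p b.-1).
Proof.
elim: b => // b IH; rewrite ltnS leq_eqVlt => /orP[/eqP<-|ltab] H.
  by rewrite !big_nat1 mulrC.
rewrite !big_nat_recr ?(ltnW ltab) //= mulrAC IH //; last by move=> j h1 h2; apply: H => //; lia.
by have := H b.-1; rewrite prednK ?ltnSn; [move=> -> //; lia|lia].
Qed.

(* alpha_{t+1} of the paper, including alpha_{m+1} = 0; the 0-based rows [j] with
   [corner_row t.+1 <= j < corner_row t] have consecutive parts. *)
Definition corner_row (m : nat) (alpha : nat -> nat) (t : nat) : nat :=
  if t == m then 0%N else alpha t.+1.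

Section Corners.

Variables (lam : seq nat) (m : nat) (alpha beta : nat -> nat).
Hypothesis sl : strict lam.
Hypothesis corners :
  forall c, outer_corner lam c <-> exists2 j, (1 <= j <= m)%N & c = (alpha j, beta j).
Hypothesis alpha_decr : forall j, (1 <= j < m)%N -> (alpha j.+1 < alpha j)%N.

Let run := corner_row m alpha.

Lemma corner_row_spec t : (t < m)%N ->
  [/\ (0 < run t)%N, (run t <= size lam)%N & beta t.+1 = (run t + nth 0 lam (run t).-1)%N].
Proof.
move=> ht; have /outer_corner_col[/= /andP[]] : outer_corner lam (alpha t.+1, beta t.+1).
  by apply/corners; exists t.+1.
by rewrite /run /corner_row ltn_eqF.
Qed.

Lemma corner_row_decr s t : (s < t <= m)%N -> (run t < run s)%N.
Proof.
elim: t => // t IH /andP[]; rewrite ltnS leq_eqVlt => h ht.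
have {}h1 : (run t.+1 < run t)%N.
  have [h2 _ _] := corner_row_spec t ht; rewrite {1}/run /corner_row; case: eqP => // /eqP h3.
  by rewrite /run /corner_row ltn_eqF //; apply: alpha_decr; lia.
case/orP: h => [/eqP-> //|h]; apply: ltn_trans h1 _; apply: IH; lia.
Qed.

Lemma corner_row_surj a : (a < size lam)%N ->
    (a.+1 == size lam) || ((nth 0 lam a.+1).+1 < nth 0 lam a)%N ->
  exists2 t, (t < m)%N & run t = a.+1.
Proof.
move=> lta ha; have /corners[[|t] // ht [e _]] := outer_corner_row lam a sl lta ha.
by exists t; [lia | rewrite /run /corner_row ltn_eqF //; lia].
Qed.

(** The last row of a nonempty diagram ends in an outer corner, which must be the first one because
    [run] decreases. The empty diagram has no corner, so there [m = 0]. *)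
Lemma corner_row0 : run 0 = size lam.
Proof.
case: (posnP (size lam)) => [e|h].
  by rewrite e /run /corner_row; case: eqP => // /eqP m0; have [] := corner_row_spec 0; rewrite ?e /run /corner_row; lia.
have [||t ht e] := corner_row_surj (size lam).-1; rewrite ?prednK ?eqxx //.
rewrite prednK // in e; have [_ h1 _] := corner_row_spec 0 ltac:(lia).
case: (posnP t) => [e0|t0]; first by rewrite -e e0.
by have := corner_row_decr 0 t; lia.
Qed.

(** A drop of at least 2 after row [j] would create an outer corner strictly between two successive
    ones. *)
Lemma corner_row_consecutive t j : (t < m)%N -> (run t.+1 <= j)%N -> (j.+1 < run t)%N ->
  nth 0%N lam j = (nth 0 lam j.+1).+1.
Proof.
move=> ht h1 h2; have [_ h3 _] := corner_row_spec t ht.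
have ltj : (j < size lam)%N by lia.
have := strict_ltn_nth sl (ltnSn j) ltj; rewrite leq_eqVlt => /orP[/eqP<- //|h].
have [|s hs e] := corner_row_surj j ltj; first by rewrite h orbT.
have := corner_row_decr s t; have := corner_row_decr t s; have := corner_row_decr t.+1 s.
case: (ltngtP s t) => h4; try lia; last by rewrite h4 in e; lia.
by case: (eqVneq s t.+1) => [e1|]; [rewrite e1 in e; lia | lia].
Qed.

Lemma yc_corner_row t : (t < m)%N -> yc alpha beta t.+1 = nth 0%N lam (run t).-1.
Proof.
by move=> ht; have [_ _] := corner_row_spec t ht; rewrite /yc /run /corner_row ltn_eqF // => ->; rewrite addKn.
Qed.

(** The content equals the smallest part of the run plus the length of the run, and parts grow by 1
    per row going up, so it is one more than the largest part. *)
Lemma xc_corner_row t : (t < m)%N -> xc lam m alpha beta t.+1 = (nth 0%N lam (run t.+1)).+1.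
Proof.
move=> ht; rewrite /xc /= -/(corner_row m alpha t.+1) -/(run t.+1); have [h1 h2 ->] := corner_row_spec t ht.
have lt : (run t.+1 < run t)%N by apply: corner_row_decr; lia.
suff H d : (run t.+1 + d < run t)%N ->
    nth 0%N lam (run t.+1) = (nth 0 lam (run t.+1 + d) + d)%N.
  have := H ((run t).-1 - run t.+1)%N; rewrite subnKC; last by lia.
  by move=> -> //; lia.
elim: d => [|d IH] hd; first by rewrite !addn0.
by rewrite IH ?(corner_row_consecutive t (run t.+1 + d)) ?addnS //; lia.
Qed.

Lemma xc0 : xc lam m alpha beta 0 = 1%N.
Proof. by rewrite /xc eqxx -/(corner_row m alpha 0) -/(run 0) corner_row0 subSnn. Qed.

Lemma corners_telescope (R : comPzRingType) (f : nat -> R) :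
  \prod_(0 <= j < size lam) f (nth 0%N lam j) * \prod_(1 <= j < m.+1) f (xc lam m alpha beta j)
  = \prod_(0 <= j < size lam) f (nth 0%N lam j).+1 * \prod_(1 <= j < m.+1) f (yc alpha beta j).
Proof.
rewrite !big_add1 /= -corner_row0.
(* The runs are added from the top of the diagram downwards, starting from the empty product at
   [run m = 0]. *)
suff H d : (d <= m)%N ->
    \prod_(0 <= j < run (m - d)) f (nth 0%N lam j) * \prod_(m - d <= j < m) f (xc lam m alpha beta j.+1)
    = \prod_(0 <= j < run (m - d)) f (nth 0%N lam j).+1 * \prod_(m - d <= j < m) f (yc alpha beta j.+1).
  by have := H m (leqnn m); rewrite subnn.
elim: d => [|d IH] hd; first by rewrite subn0 /run /corner_row eqxx !big_geq.
have {IH} := IH (ltnW hd); have ltm : (m - d.+1 < m)%N by lia.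
have -> : (m - d = (m - d.+1).+1)%N by lia.
move: (m - d.+1)%N ltm => t ht IH.
have lt : (run t.+1 < run t)%N by apply: corner_row_decr; lia.
rewrite !(big_cat_nat (leq0n _) (ltnW lt)) /= ![\prod_(t <= _ < _) _]big_ltn //.
rewrite (mulrC (f (xc _ _ _ _ _))) (mulrC (f (yc _ _ _))) [LHS]mulrACA [RHS]mulrACA IH xc_corner_row // yc_corner_row //.
congr (_ * _); apply: run_telescope => // j h1 h2; exact: corner_row_consecutive ht h1 h2.
Qed.

End Corners.

(** * Evaluation of the telescoped product at the content of the added box *)

Theorem theorem3p1 (lam lamp : seq nat) (m : nat) (alpha beta : nat -> nat)
    (i : nat) (b : nat * nat) :
  strict lam ->
  (forall c, outer_corner lam c <-> exists2 j, (1 <= j <= m)%N & c = (alpha j, beta j)) ->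
  (forall j, (1 <= j < m)%N -> (alpha j.+1 < alpha j)%N) ->
  (i <= m)%N ->
  strict lamp ->
  ~~ in_diag lam b ->
  (forall c, in_diag lamp c = in_diag lam c || (c == b)) ->
  content b = xc lam m alpha beta i ->
  let ratio := (Hprod lam)%:R / (Hprod lamp)%:R : rat in
  (i = 0%N ->
     ratio = (\prod_(1 <= j < m.+1) (binom2 (xc lam m alpha beta 0) - binom2 (yc alpha beta j)))
           / (\prod_(1 <= j < m.+1) (binom2 (xc lam m alpha beta 0) - binom2 (xc lam m alpha beta j))))
  /\
  ((1 <= i)%N ->
     ratio = 2^-1 * ((\prod_(1 <= j < m.+1) (binom2 (xc lam m alpha beta i) - binom2 (yc alpha beta j)))
           / (\prod_(0 <= j < m.+1 | j != i) (binom2 (xc lam m alpha beta i) - binom2 (xc lam m alpha beta j))))).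
Proof.
move=> sl corners decr leim slp nb Eb; have [k [-> Ep]] := add_box_nth _ _ _ nb Eb => xi ratio.
have [ltk hs Hr] := Hprod_add_box _ _ k sl slp Ep.
rewrite {}/ratio {}Hr; set x := (nth 0%N lam k).+1 in xi *.
(* Giving [f] the value 1 at [x] drops the vanishing factors from both sides of [corners_telescope]. *)
pose f v : rat := if v == x then 1 else binom2 x - binom2 v.
have fE v : v != x -> f v = binom2 x - binom2 v by rewrite /f => /negPf->.
have f0 v : (0 < v)%N -> f v != 0.
  move=> v0; rewrite /f; case: (eqVneq v x) => [_|]; first exact: oner_neq0.
  by apply: contraNneq => /subr0_eq /binom2_inj_gt0 ->.
have pj j : j != k -> nth 0%N lamp j = nth 0%N lam j by move=> ne; rewrite Ep (negPf ne) addn0.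
have pk : nth 0%N lamp k = x by rewrite Ep eqxx addn1.
have ltj j : (j < size lamp)%N -> j != k -> (j < size lam)%N.
  move=> lt ne; have := strict_nth_gt0 slp lt; rewrite pj // ltnNge => h.
  by rewrite ltnNge; apply: contra h => h; rewrite nth_default.
(* [lamp] is strict and has the part [x] in row [k], so no other row has it. *)
have px j : nth 0%N lam j != x.
  case: (eqVneq j k) => [->|ne]; first by rewrite /x; lia.
  by apply/eqP; rewrite -pj // -pk => e; have := strict_nth_inj slp ltk (esym e); move/eqP: ne; auto.
have telescope : \prod_(0 <= j < size lam) (f (nth 0%N lam j) / f (nth 0%N lam j).+1)
    = (\prod_(1 <= j < m.+1) (binom2 x - binom2 (yc alpha beta j)))
      / \prod_(1 <= j < m.+1) f (xc lam m alpha beta j).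
  (* Outer corner contents are parts of [lam], hence differ from [x], and [f] is the true difference
     there. *)
  have -> : \prod_(1 <= j < m.+1) (binom2 x - binom2 (yc alpha beta j))
      = \prod_(1 <= j < m.+1) f (yc alpha beta j).
    rewrite !big_add1 big_nat [RHS]big_nat; apply: eq_bigr => j /= hj.
    by rewrite (yc_corner_row lam m alpha beta corners) // fE.
  rewrite prodf_div; apply/eqP; rewrite eqr_div.
  - by rewrite (corners_telescope lam m alpha beta) // mulrC.
  - by rewrite prodf_seq_neq0; apply/allP => j _; rewrite f0.
  rewrite big_add1 prodf_seq_neq0; apply/allP => j; rewrite mem_index_iota => hj.
  by rewrite (xc_corner_row lam m alpha beta) // f0.
have fnk : \prod_(0 <= j < size lamp | j != k)
    ((binom2 x - binom2 (nth 0%N lam j)) / (binom2 x - binom2 (nth 0%N lam j).+1))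
    = \prod_(0 <= j < size lamp | j != k) (f (nth 0%N lam j) / f (nth 0%N lam j).+1).
  rewrite big_seq_cond [RHS]big_seq_cond; apply: eq_bigr => j; rewrite mem_index_iota => /andP[hj ne].
  rewrite !fE // eqSS; apply/eqP => e; move/eqP: (ne); apply.
  by apply: (strict_nth_inj sl _ e); apply: ltj => //; apply/eqP => e'; rewrite e' eqxx in ne.
rewrite {}fnk; have x0 := xc0 lam m alpha beta sl corners decr.
have xS t := xc_corner_row lam m alpha beta sl corners decr t.
have lt_run s t : (s < t <= m)%N -> (corner_row m alpha t < corner_row m alpha s)%N.
  exact: (corner_row_decr lam m alpha beta sl corners decr).
have lt_size t : (t < m)%N -> (corner_row m alpha t.+1 < size lam)%N.
  move=> ht; rewrite -(corner_row0 lam m alpha beta sl corners decr).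
  by apply: lt_run.
have xS2 t : (t < m)%N -> (1 < xc lam m alpha beta t.+1)%N.
  by move=> ht; rewrite xS // ltnS strict_nth_gt0 // lt_size.
split=> [i0|i0].
  rewrite i0 x0 in xi; rewrite x0 {1}xi invr1 mul1r.
  (* Here [x = 1], so the part in row [k] is 0 and the box opens a new row; the excluded index is
     the padding row. *)
  have k_ge : (size lam <= k)%N.
    by rewrite leqNgt; apply/negP => /(strict_nth_gt0 sl); move: xi; rewrite /x; lia.
  have [ek en] : k = size lam /\ size lamp = (size lam).+1 by lia.
  rewrite en ek big_mkcond big_nat_recr //= eqxx mulr1.
  transitivity (\prod_(0 <= j < size lam) (f (nth 0%N lam j) / f (nth 0%N lam j).+1)).
    by rewrite big_nat [RHS]big_nat; apply: eq_bigr => j /= hj; rewrite ifT //; lia.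
  rewrite telescope xi; congr (_ / _); rewrite !big_add1 big_nat [RHS]big_nat.
  by apply: eq_bigr => j /= hj; rewrite fE xi //; have := xS2 j; lia.
case: i i0 leim xi => // i _ lti xi; rewrite -xi.
have x_gt1 : (1 < x)%N by rewrite xi xS2.
have ltkl : (k < size lam)%N.
  by rewrite ltnNge; apply/negP => h; move: x_gt1; rewrite /x nth_default.
have {}en : size lamp = size lam by have := ltj (size lam); lia.
rewrite en; move: telescope.
(* Row [k] contributes [f (x - 1) / f x] with [f x = 1]; removing it leaves
   [binom2 x - binom2 (x - 1) = x - 1] in the denominator. *)
rewrite (bigD1_seq k) ?iota_uniq ?mem_index_iota //= -/x {2}/f eqxx divr1 => /(canRL (mulKf _)) ->; last first.
  by rewrite f0 //; move: x_gt1; rewrite /x; lia.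
(* The value [f x = 1] deletes the factor of the box's own corner. The other inner corner contents
   differ from [x] because distinct runs have distinct largest parts. *)
have -> : \prod_(1 <= j < m.+1) f (xc lam m alpha beta j)
    = \prod_(1 <= j < m.+1 | j != i.+1) (binom2 x - binom2 (xc lam m alpha beta j)).
  rewrite [RHS]big_mkcond; apply: eq_big_seq => -[|j]; rewrite mem_index_iota // => hj.
  case: eqVneq => [->|ne] /=; first by rewrite /f -xi eqxx.
  rewrite fE // xi !xS // eqSS; apply/eqP => /(strict_nth_inj sl (lt_size _ _)) e.
  have := lt_run j.+1 i.+1; have := lt_run i.+1 j.+1; lia.
(* The corner of content 1 contributes [x (x - 1) / 2], which absorbs the factors [x] and [x - 1]
   and accounts for the constant one half. *)
rewrite [X in _ = _ * (_ / X)]big_ltn_cond //= x0 fE //.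
have -> : binom2 x - binom2 (nth 0%N lam k) = x%:R - 1.
  by rewrite !binom2E /x -[(nth _ _ _).+1]addn1 natrD; field.
have -> : binom2 x - binom2 1 = x%:R * (x%:R - 1) / 2 by rewrite !binom2E subrr mulr0 mul0r subr0.
rewrite !invfM invrK !mulrA; congr (_ / _).
have nx : x%:R != 0 :> rat by rewrite pnatr_eq0.
have nx1 : x%:R - 1 != 0 :> rat by rewrite subr_eq0 pnatr_eq1; lia.
by field; rewrite nx nx1.
Qed.
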